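(* Let $E\in\mathbb{R}^{n\times n}$ and let $W\in\mathbb{R}^{n\times n}$ be symmetric positive definite. With respect to the weighted inner product $\langle a,b\rangle_W=a^\top W b$ on $\mathbb{R}^n$, the $W$-orthogonal complement of $\ker E$ is $$(\ker E)^{\perp_W}=\operatorname{Im}\bigl(W^{-1}E^\top\bigr).$$
   Context: $(\ker E)^{\perp_W}=\{z\in\mathbb{R}^n: z^\top Wx=0\ \text{for all }x\in\ker E\}$, and $\operatorname{Im}$ denotes the image (column space) of a matrix. *)

(* Defs.v *)
From mathcomp Require Import all_boot all_order all_algebra.
From mathcomp Require Import classical_sets reals.
Set Implicit Arguments.
Unset Strict Implicit.
Unset Printing Implicit Defensive.
Import Order.TTheory GRing.Theory Num.Theory.
Local Open Scope classical_set_scope.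
Local Open Scope ring_scope.

(* Vectors are columns. MathComp's [kermx], row spaces and [orthomx] act on
   rows, so subspaces are represented here as plain sets of column vectors. *)

Definition winner (R : realType) (n : nat) (W : 'M[R]_n) (a b : 'cV[R]_n) : R :=
  (a^T *m W *m b) 0 0.

Definition sym_posdef (R : realType) (n : nat) (W : 'M[R]_n) : Prop :=
  W^T = W /\ forall x : 'cV[R]_n, x != 0 -> 0 < (x^T *m W *m x) 0 0.

Definition mxker (R : realType) (m n : nat) (A : 'M[R]_(m, n)) :
    set 'cV[R]_n :=
  [set x | A *m x = 0].

Definition mxim (R : realType) (m n : nat) (A : 'M[R]_(m, n)) :
    set 'cV[R]_m :=
  range (fun y : 'cV[R]_n => A *m y).

Definition wperp (R : realType) (n : nat) (W : 'M[R]_n) (S : set 'cV[R]_n) :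
    set 'cV[R]_n :=
  [set z | forall x, S x -> winner W z x = 0].

(* Main.v *)
Require Import Defs.
From mathcomp Require Import all_boot all_order all_algebra.
From mathcomp Require Import classical_sets reals.
Import Order.TTheory GRing.Theory Num.Theory.
Local Open Scope ring_scope.

(** A vector z is W-orthogonal to ker E iff the row [z^T *m W] annihilates ker E, i.e. lies in the
    row space of E ([submx_of_ker]). Transposing and inverting W turns this into z being in the
    image of W^-1 E^T. *)

Lemma sym_posdef_unitmx {R : realType} {n : nat} {W : 'M[R]_n} :
  sym_posdef W -> W \in unitmx.
Proof.
move=> [_ Wpos]; rewrite -row_free_unit; apply: inj_row_free => v vW0.
apply/eqP; rewrite -trmx_eq0; apply: contraT => /Wpos.
by rewrite trmxK vW0 mul0mx mxE ltxx.
Qed.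

(** The columns of [cokermx E] lie in ker E, so u kills each of them; [u *m cokermx E = 0]
    characterises the row space. *)
Lemma submx_of_ker (F : fieldType) (m n : nat) (E : 'M[F]_(m, n))
    (u : 'rV[F]_n) :
  (forall x : 'cV[F]_n, E *m x = 0 -> (u *m x) 0 0 = 0) -> (u <= E)%MS.
Proof.
move=> uker; rewrite submxE; apply/eqP/matrixP => i j; rewrite ord1 [RHS]mxE.
have := uker (col j (cokermx E)).
rewrite colE mulmxA mulmx_coker mul0mx => /(_ erefl).
by rewrite mulmxA -colE mxE.
Qed.

Theorem proposition2p2 (R : realType) (n : nat) (E W : 'M[R]_n)
    (hW : sym_posdef W) :
  wperp W (mxker E) = mxim (invmx W *m E^T).
Proof.
have Wu := sym_posdef_unitmx hW; have Wsym : W^T = W by case: hW.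
apply/seteqP; split => [z zperp | _ [y _ <-] x Ex0].
  have /submxP[D zWE] : (z^T *m W <= E)%MS by apply: submx_of_ker => x /zperp.
  (* Transposing z^T W = D E gives W z = E^T D^T, as W is symmetric. *)
  exists D^T => //.
  by rewrite -mulmxA -trmx_mul -zWE trmx_mul trmxK Wsym mulKmx.
(* The factors W^-1 and W cancel, leaving y^T E x = 0. *)
by rewrite /winner !trmx_mul trmxK trmx_inv Wsym mulmxA mulmxKV // -mulmxA Ex0
           mulmx0 mxE.
Qed.
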